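(* Let $N\ge1$, $p\ge2$, $w,g\in L^1_{loc}(\mathbb{R}^N)$ positive a.e. with $g^{-1}\in L^\infty(\mathbb{R}^N)$. Let $0<\delta<\gamma$ with $(\delta,p)$ in the class $P_a$. Let $u\in C^1(\mathbb{R}^N)$ with $0<u\le1$ in $\mathbb{R}^N$ be a stable weak solution of $\operatorname{div}(w|\nabla u|^{p-2}\nabla u)=g(x)(u^{-\delta}+u^{-\gamma})$ in $\mathbb{R}^N$. Then for every $\beta\in(0,s_p)$ there exists a constant $c>0$, depending on $\beta,p,\delta,m$ but not on $\psi$, such that for every $\psi\in C^1_c(\mathbb{R}^N)$ with $0\le\psi\le1$, $$\int_{\mathbb{R}^N} g\Big(\frac{\psi}{u}\Big)^{2\beta+p-1+\delta}dx\le c\int_{\mathbb{R}^N} w^{\theta_a'}|\nabla\psi|^{p\theta_a'}dx,\qquad \theta_a'=\frac{2\beta+p-1+\delta}{p-1+\delta}.$$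
   Context: Here $m=\|g^{-1}\|_{L^\infty}$. Weak solution and stability are with respect to $f(t)=-t^{-\delta}-t^{-\gamma}$ and the equation $-\operatorname{div}(w|\nabla u|^{p-2}\nabla u)=gf(u)$: $u\in C^1$ is a weak solution if $\int w|\nabla u|^{p-2}\nabla u\cdot\nabla\varphi=\int gf(u)\varphi$ for all $\varphi\in C^1_c(\mathbb{R}^N)$; it is stable if for all $\varphi\in C^1_c(\mathbb{R}^N)$, $\int w|\nabla u|^{p-2}|\nabla\varphi|^2+(p-2)\int w|\nabla u|^{p-4}(\nabla u\cdot\nabla\varphi)^2-\int gf'(u)\varphi^2\ge0$ (middle integrand $=0$ where $\nabla u=0$). Class $P_a$: $(\delta,p)\in P_a$ if either $2\le p<3$ and $\delta\ge1$, or $p=3$ and $\delta>1$, or $p>3$ and $\delta>\frac{(p-1)^2}{4}$. $s_p=\delta+\sqrt{\delta^2+\delta}$ if $p=2$, $s_p=\frac{2\delta}{p-1}-\frac{p-1}{2}$ if $p>2$. *)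

(* Defs.v *)
(* R^N is modelled as 'rV[R]_N with
   N = n.+1 (N >= 1), and N-dimensional Lebesgue measure is the iterated
   product measure (library's \x) of 1-dimensional Lebesgue measures,
   transported to 'rV[R]_N by the explicit coordinate map [es_vec]. *)
From HB Require Import structures.
From mathcomp Require Import all_boot all_order all_algebra.
From mathcomp Require Import all_classical all_reals all_analysis.
From mathcomp Require Import ess_sup_inf.
Import Order.TTheory GRing.Theory Num.Theory.
Import numFieldNormedType.Exports.
Set Implicit Arguments. Unset Strict Implicit.
Unset Printing Implicit Defensive.
Local Open Scope classical_set_scope.
Local Open Scope ring_scope.

Record euclid_space (R : realType) (n : nat) := EuclidSpace {
  es_disp : measure_display;
  es_type : measurableType es_disp;
  es_meas : {measure set es_type -> \bar R};
  es_vec : es_type -> 'rV[R]_n.+1 }.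

(* Lebesgue measure on R^(n+1): R x R x ... x R with the product measure;
   the point (y, t) (y in R^n', t in R) is sent to the row vector (t, y). *)
Fixpoint leb_space (R : realType) (n : nat) : euclid_space R n :=
  match n with
  | 0 => @EuclidSpace R 0 _ (measurableTypeR R) (@lebesgue_measure R)
           (fun x => \row_(i < 1) x)
  | n'.+1 => let S := leb_space R n' in
     @EuclidSpace R n'.+1 _ (es_type S * measurableTypeR R)%type
       (Measure.clone _ _ _ ((es_meas S) \x (@lebesgue_measure R))%E _)
       (fun p => row_mx (\row_(i < 1) p.2) (@es_vec _ _ S p.1))
  end.

Section defs.
Variable R : realType.
Variable n : nat.   (* dimension N = n.+1 *)

Local Notation S := (leb_space R n).
Local Notation mu := (@es_meas R n S).
Local Notation vec := (@es_vec R n S).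

Definition intRN (F : 'rV[R]_n.+1 -> \bar R) : \bar R :=
  (\int[mu]_x F (vec x))%E.

Definition intRN_on (K : set 'rV[R]_n.+1) (F : 'rV[R]_n.+1 -> \bar R) : \bar R :=
  (\int[mu]_(x in vec @^-1` K) F (vec x))%E.

Definition measurableRN (F : 'rV[R]_n.+1 -> R) : Prop :=
  measurable_fun setT (F \o vec).

Definition L1loc (w : 'rV[R]_n.+1 -> R) : Prop :=
  measurableRN w /\
  forall K : set 'rV[R]_n.+1, compact K ->
    (intRN_on K (fun x => (`|w x|)%:E) < +oo)%E.

Definition ae_RN (P : 'rV[R]_n.+1 -> Prop) : Prop :=
  (\forall x \ae mu, P (vec x)).

Definition esssup_abs (h : 'rV[R]_n.+1 -> R) : \bar R :=
  ess_sup mu (fun x => (`|h (vec x)|)%:E).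

Definition dotRN (v v' : 'rV[R]_n.+1) : R := \sum_(i < n.+1) v ord0 i * v' ord0 i.
Definition enorm (v : 'rV[R]_n.+1) : R := Num.sqrt (dotRN v v).

Definition grad (u : 'rV[R]_n.+1 -> R) (x : 'rV[R]_n.+1) : 'rV[R]_n.+1 :=
  \row_(i < n.+1) ('D_(delta_mx ord0 i) u x).

Definition C1 (u : 'rV[R]_n.+1 -> R) : Prop :=
  (forall x, differentiable u x) /\
  (forall i : 'I_n.+1, continuous (fun x => 'D_(delta_mx ord0 i) u x)).

Definition C1c (phi : 'rV[R]_n.+1 -> R) : Prop :=
  C1 phi /\ compact (closure [set x | phi x != 0]).

End defs.

Section nonlinearity.
Variable R : realType.

Definition fnl (delta gamma t : R) : R := - (t `^ (- delta)) - t `^ (- gamma).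
Definition fnl' (delta gamma t : R) : R :=
  delta * t `^ (- delta - 1) + gamma * t `^ (- gamma - 1).

Definition class_Pa (delta p : R) : Prop :=
  [/\ 2 <= p, p < 3 & 1 <= delta] \/ (p = 3 /\ 1 < delta) \/
  (3 < p /\ (p - 1) ^+ 2 / 4 < delta).

Definition s_p (p delta : R) : R :=
  if p == 2 then delta + Num.sqrt (delta ^+ 2 + delta)
  else 2 * delta / (p - 1) - (p - 1) / 2.

End nonlinearity.

Section pde.
Variables (R : realType) (n : nat).
Variables (p delta gamma : R) (w g u : 'rV[R]_n.+1 -> R).

(* weak solution of -div(w|grad u|^{p-2} grad u) = g f(u) *)
Definition weak_solution : Prop :=
  C1 u /\
  forall phi, C1c phi ->
    intRN (fun x => (w x * (enorm (grad u x)) `^ (p - 2)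
                      * dotRN (grad u x) (grad phi x))%:E)
    = intRN (fun x => (g x * fnl delta gamma (u x) * phi x)%:E).

Definition stable : Prop :=
  forall phi, C1c phi ->
    (0 <= intRN (fun x => (w x * (enorm (grad u x)) `^ (p - 2)
                              * (enorm (grad phi x)) ^+ 2)%:E)
         + (p - 2)%:E *
           intRN (fun x => (w x *
              (if grad u x == 0 then 0
               else (enorm (grad u x)) `^ (p - 4)
                    * (dotRN (grad u x) (grad phi x)) ^+ 2))%:E)
         - intRN (fun x => (g x * fnl' delta gamma (u x) * (phi x) ^+ 2)%:E))%E.

End pde.

(* Main.v *)
(* Write k = 2 beta + p - 1 + delta and b = beta + (p - 2) / 2, and test the weak
   formulation with u^-(2b+1) psi^k and the stability inequality with
   u^-b psi^(k/2). Both then produce the terms w |grad u|^p u^-(2b+2) psi^k and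
   g u^(-delta-2b-1) psi^k = g (psi/u)^k. Since (p - 1) b^2 < delta (2b + 1), some
   multiplier lam with (p - 1) b^2 / (2b + 1) < lam < delta makes
   stability + lam * (weak formulation) coercive in both terms at once. The cross
   terms are absorbed pointwise, by Young-type inequalities obtained from a case
   distinction, so that a single pointwise inequality is integrated. The power of
   psi left over is harmless because delta >= 1 and 0 <= psi <= 1. *)
Require Import Defs.
From HB Require Import structures.
From mathcomp Require Import all_boot all_order all_algebra.
From mathcomp Require Import all_classical all_reals all_analysis.
From mathcomp Require Import ess_sup_inf measurable_realfun.
From mathcomp Require Import ring lra.
Import Order.TTheory GRing.Theory Num.Theory.
Import numFieldNormedType.Exports.
Local Open Scope classical_set_scope.
Local Open Scope ring_scope.

(** * Real inequalities *)

(** For [p = 2] this is [beta ^+ 2 - 2 * delta * beta - delta < 0], a quadratic inequality whose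
    positive root is [s_p]. For [p > 2], [beta < s_p p delta] is the same as
    [(p - 1) * (2 * b + 1) < 4 * delta], and [b ^+ 2 < (2 * b + 1) ^+ 2 / 4] concludes. *)
Lemma multiplier_gap (R : realType) (p delta beta : R) (b := beta + (p - 2) / 2) :
  2 <= p -> 0 < delta -> 0 < beta -> beta < s_p p delta ->
  (p - 1) * b ^+ 2 < delta * (2 * b + 1).
Proof.
move=> p2 d0 b0; rewrite /s_p /b; case: eqVneq => [->|pn2] bs.
  have -> : (2 - 1) * (beta + (2 - 2) / 2) ^+ 2 = beta ^+ 2 by field.
  have -> : delta * (2 * (beta + (2 - 2) / 2) + 1) = 2 * delta * beta + delta by field.
  have [bd|db] := leP beta delta; first by nra.
  have : (beta - delta) ^+ 2 < delta ^+ 2 + delta.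
    rewrite -[ltRHS]sqr_sqrtr; last by nra.
    by rewrite ltr_pXn2r ?nnegrE ?sqrtr_ge0//; lra.
  by nra.
have p1 : 0 < p - 1 by lra.
have := bs; rewrite -(ltr_pM2r p1).
have -> : (2 * delta / (p - 1) - (p - 1) / 2) * (p - 1) = 2 * delta - (p - 1) ^+ 2 / 2.
  by field; lra.
move=> h.
set c := beta + _.
have c0 : 0 < c by rewrite /c; lra.
have h' : (p - 1) * (2 * c + 1) < 4 * delta by rewrite /c; lra.
apply: (@lt_le_trans _ _ ((p - 1) * (2 * c + 1) / 4 * (2 * c + 1))); last first.
  by rewrite ler_pM2r; lra.
nra.
Qed.

(* For Z >= T Y the left-hand side is nonpositive, otherwise Z is bounded by T Y. *)
Lemma absorb_gradient (R : realType) (r K L M : R) :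
  0 <= r -> 0 < K -> 0 <= L -> 0 <= M ->
  exists2 C : R, 0 < C & forall Z Y : R, 0 <= Z -> 0 <= Y ->
    Z `^ r * (- K * Z ^+ 2 + L * Z * Y + M * Y ^+ 2) <= C * Y `^ (r + 2).
Proof.
(* [T] solves [K * T = K + L + M]: when [T * Y <= Z], the bracket times [T] is then at most
   [- K * Z ^+ 2]. *)
move=> r0 K0 L0 M0; pose T := 1 + (L + M) / K.
have T1 : 1 <= T by rewrite lerDl divr_ge0 ?addr_ge0// ltW.
have KT : K * T = K + (L + M) by rewrite /T; field; rewrite gt_eqF.
have LTM0 : 0 <= L * T + M by rewrite addr_ge0// mulr_ge0//; lra.
exists (T `^ r * (L * T + M + 1)) => [|Z Y Z0 Y0].
  by rewrite mulr_gt0 ?powR_gt0//; lra.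
have [TYZ|ZTY] := leP (T * Y) Z.
  apply: (@le_trans _ _ 0); last first.
    by rewrite !mulr_ge0 ?powR_ge0//; lra.
  rewrite mulr_ge0_le0 ?powR_ge0//.
  have YZ : Y <= Z by nra.
  have : L * Z * (T * Y) <= L * Z * Z by rewrite ler_wpM2l ?mulr_ge0.
  have : M * Y * (T * Y) <= M * Z * Z.
    by apply: ler_pM => //; rewrite ?mulr_ge0 ?ler_wpM2l//; lra.
  have : 0 <= K * Z ^+ 2 by rewrite mulr_ge0 ?sqr_ge0// ltW.
  move=> h1 h2 h3.
  suff : T * (- K * Z ^+ 2 + L * Z * Y + M * Y ^+ 2) <= 0 by rewrite pmulr_rle0//; lra.
  have -> : T * (- K * Z ^+ 2 + L * Z * Y + M * Y ^+ 2)
    = - (K * T) * Z ^+ 2 + L * Z * (T * Y) + M * Y * (T * Y) by ring.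
  rewrite KT; nra.
have -> : Y `^ (r + 2) = Y `^ r * Y ^+ 2.
  rewrite powRD ?powR_mulrn//; apply/implyP => /eqP; lra.
have ZrT : Z `^ r <= T `^ r * Y `^ r.
  by rewrite -powRM ?ge0_ler_powR ?nnegrE ?mulr_ge0 ?(ltW ZTY)//; lra.
have hb : - K * Z ^+ 2 + L * Z * Y + M * Y ^+ 2 <= (L * T + M + 1) * Y ^+ 2.
  have : L * Z * Y <= L * (T * Y) * Y.
    by rewrite ler_wpM2r// ler_wpM2l// ltW.
  have : 0 <= K * Z ^+ 2 by rewrite mulr_ge0 ?sqr_ge0// ltW.
  have := sqr_ge0 Y; lra.
apply: (le_trans (ler_wpM2l (powR_ge0 _ _) hb)).
have -> : T `^ r * (L * T + M + 1) * (Y `^ r * Y ^+ 2) =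
   (T `^ r * Y `^ r) * ((L * T + M + 1) * Y ^+ 2) by ring.
rewrite ler_wpM2r// mulr_ge0 ?sqr_ge0//; lra.
Qed.

(** Either [A * W] is below [e * g * V ^ q] and the first term on the right suffices, or [g >= m]
    forces [V ^ q <= Q * W], and the second term suffices. Only the lower bound [m] of the weight
    enters [C]. *)
Lemma weighted_young (R : realType) (A e m q r : R) :
  0 < A -> 0 < e -> 0 < m -> 0 < q -> 0 < r ->
  exists2 C : R, 0 < C & forall g V W : R, m <= g -> 0 <= V -> 0 <= W ->
    A * V `^ r * W <= e * (g * V `^ (r + q)) + C * W `^ ((r + q) / q).
Proof.
move=> A0 e0 m0 q0 r0; pose Q := A / (e * m).
have Q0 : 0 < Q by rewrite divr_gt0// mulr_gt0.
exists (A * (Q `^ (q^-1 * r))) => [|g V W mg V0 W0].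
  by rewrite mulr_gt0// powR_gt0.
have g0 : 0 < g by exact: lt_le_trans mg.
have rq0 : r + q != 0 by lra.
have VD : V `^ (r + q) = V `^ r * V `^ q by rewrite powRD// (negbTE rq0).
have [h|h] := leP (A * W) (e * (g * V `^ q)).
  apply: ler_wpDr; first by rewrite mulr_ge0 ?powR_ge0// mulr_ge0 ?powR_ge0// ltW.
  rewrite VD.
  have -> : A * V `^ r * W = V `^ r * (A * W) by ring.
  have -> : e * (g * (V `^ r * V `^ q)) = V `^ r * (e * (g * V `^ q)) by ring.
  by rewrite ler_wpM2l// powR_ge0.
apply: ler_wpDl; first by rewrite !mulr_ge0 ?powR_ge0// ltW.
have VQ : V `^ q <= Q * W.
  rewrite -(@ler_pM2l _ (e * m)) ?mulr_gt0// /Q.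
  have -> : e * m * (A / (e * m) * W) = A * W by field; lra.
  by apply: le_trans (ltW h); rewrite -mulrA ler_pM2l// ler_wpM2r// powR_ge0.
have VW : V `^ r <= Q `^ (q^-1 * r) * W `^ (q^-1 * r).
  rewrite -powRM ?(ltW Q0)//.
  have -> : V `^ r = (V `^ q) `^ (q^-1 * r).
    by rewrite -powRrM mulrA divff ?mul1r// gt_eqF.
  apply: ge0_ler_powR => //; rewrite ?nnegrE ?powR_ge0//.
  - by rewrite mulr_ge0 ?invr_ge0// ltW.
  - by rewrite mulr_ge0// ltW.
have -> : W `^ ((r + q) / q) = W `^ (q^-1 * r) * W.
  have -> : (r + q) / q = q^-1 * r + 1 by field; lra.
  rewrite powRD ?powRr1//; apply/implyP => /eqP.
  have : 0 < q^-1 * r by rewrite mulr_gt0 ?invr_gt0.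
  lra.
have -> : A * Q `^ (q^-1 * r) * (W `^ (q^-1 * r) * W)
  = A * (Q `^ (q^-1 * r) * W `^ (q^-1 * r)) * W by ring.
by rewrite ler_wpM2r// ler_wpM2l// ltW.
Qed.

(** For [p > 3] the threshold [(p - 1) ^+ 2 / 4] exceeds 1. This bound controls the spare power of
    [psi] in the energy estimate. *)
Lemma class_Pa_ge1 (R : realType) (delta p : R) : class_Pa delta p -> 1 <= delta.
Proof.
case=> [[]//|[[_ /ltW//]|[p3 h]]].
apply: le_trans (ltW h); nra.
Qed.

Lemma multiplier_exists (R : realType) (p delta a b : R) :
  0 < a -> 2 <= p -> (p - 1) * b ^+ 2 < delta * a ->
  exists lam : R, [/\ 0 <= lam, (p - 1) * b ^+ 2 < lam * a & lam < delta].
Proof.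
move=> a0 p2 gap; exists (((p - 1) * b ^+ 2 / a + delta) / 2).
have h : (p - 1) * b ^+ 2 / a < delta by rewrite ltr_pdivrMr.
have h0 : 0 <= (p - 1) * b ^+ 2 / a.
  by rewrite mulr_ge0 ?invr_ge0 ?(ltW a0)// mulr_ge0 ?sqr_ge0//; lra.
by split; rewrite -?ltr_pdivrMr//; lra.
Qed.

(** The form dominates [(b * Z - h * Y) ^+ 2]. It is the squared gradient of the second test
    function, up to a positive factor. *)
Lemma cross_term_ge0 (R : realType) (b h Z Y d : R) :
  0 <= b -> 0 <= h -> `|d| <= Z * Y ->
  0 <= b ^+ 2 * Z ^+ 2 - b * (2 * h) * d + h ^+ 2 * Y ^+ 2.
Proof.
move=> b0 h0 /ler_normlW dZY.
have : b * h * d <= b * h * (Z * Y) by rewrite ler_wpM2l// mulr_ge0.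
have := sqr_ge0 (b * Z - h * Y); lra.
Qed.

(** Cauchy-Schwarz for [grad u] and [a *: grad u + r *: grad psi], in scalar form: the two sides
    differ by [r ^+ 2 * (X ^+ 2 * Y ^+ 2 - D ^+ 2)]. *)
Lemma combination_sqr_le (R : realType) (a r X Y D : R) :
  0 <= X -> 0 <= Y -> `|D| <= X * Y ->
  (a * X ^+ 2 + r * D) ^+ 2
  <= X ^+ 2 * (a ^+ 2 * X ^+ 2 + 2 * a * r * D + r ^+ 2 * Y ^+ 2).
Proof.
move=> X0 Y0 DXY.
have CS : D ^+ 2 <= (X * Y) ^+ 2.
  by rewrite -(real_normK (num_real D)) lerXn2r ?nnegrE ?mulr_ge0.
have := ler_wpM2l (sqr_ge0 r) CS; lra.
Qed.

(* Here t, s, X, Y, D stand for u, psi, |grad u|, |grad psi| and their scalar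
   product; a1, r1 and a2, r2 are the coefficients of grad u and grad psi in the
   gradients of u^-a psi^k and u^-b psi^(k/2). *)
Lemma energy_pointwise (R : realType) (p delta beta m k a b : R) :
  k = 2 * beta + p - 1 + delta -> a = 2 * beta + p - 1 ->
  b = beta + (p - 2) / 2 ->
  2 <= p -> 1 <= delta -> 0 < beta -> beta < s_p p delta -> 0 < m ->
  exists c mu lam : R, [/\ 0 < c, 0 <= mu &
  forall gamma w g t s X Y D a1 r1 a2 r2 : R, delta < gamma -> 0 < w -> m <= g ->
    0 < t -> 0 <= s <= 1 -> 0 <= X -> 0 <= Y -> `|D| <= X * Y ->
    a1 = - a * t `^ (- a - 1) * s `^ k ->
    r1 = t `^ (- a) * (k * s `^ (k - 1)) ->
    a2 = - b * t `^ (- b - 1) * s `^ (k / 2) ->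
    r2 = t `^ (- b) * (k / 2 * s `^ (k / 2 - 1)) ->
    g * (s / t) `^ k + mu * (
      w * X `^ (p - 2) * (a2 ^+ 2 * X ^+ 2 + 2 * a2 * r2 * D + r2 ^+ 2 * Y ^+ 2)
      + (p - 2) * (w * (if X == 0 then 0
                        else X `^ (p - 4) * (a2 * X ^+ 2 + r2 * D) ^+ 2))
      - g * fnl' delta gamma t * (t `^ (- b) * s `^ (k / 2)) ^+ 2
      + lam * (w * X `^ (p - 2) * (a1 * X ^+ 2 + r1 * D)
               - g * fnl delta gamma t * (t `^ (- a) * s `^ k)))
    <= c * (w `^ (k / (p - 1 + delta)) * Y `^ (p * (k / (p - 1 + delta))))].
Proof.
move=> kD aD bD p2 d1 be0 bes m0.
have d0 : 0 < delta by lra.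
have b0 : 0 <= b by lra.
have ab : a = 2 * b + 1 by rewrite aD bD; field.
have kad : k = a + delta by rewrite kD aD.
have kpE : 2 * beta <= k - p by lra.
have kE : 2 * beta + (p - 1 + delta) = k by rewrite kD; ring.
have b2 : 2 * b = 2 * beta + p - 2 by rewrite bD; field.
have k2 : 2 < k by lra.
have k0 : 0 < k by lra.
have kh0' : 0 <= k / 2 by lra.
have p20 : 0 <= p - 2 by lra.
have kN0 : k != 0 by rewrite gt_eqF//; lra.
have k1N0 : k - 1 != 0 by rewrite gt_eqF//; lra.
have kh0 : k / 2 != 0 by rewrite gt_eqF//; lra.
have kh1 : k / 2 - 1 != 0 by rewrite gt_eqF//; lra.
have [||lam [lam0 lama lamd]] := @multiplier_exists R p delta a b _ p2.
- by lra.
- by rewrite ab bD; exact: multiplier_gap.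
have dl0 : 0 < delta - lam by lra.
(* These are the coefficients of the quadratic form reached in [quad] below, in the variables
   [Z = psi |grad u| / u] and [Y = |grad psi|]. *)
have [||||C1 C10 HC1] := @absorb_gradient R (p - 2) (lam * a - (p - 1) * b ^+ 2)
  (k * `|lam - (p - 1) * b|) ((p - 1) * (k / 2) ^+ 2).
- by lra.
- by lra.
- by rewrite mulr_ge0//; lra.
- by rewrite mulr_ge0 ?sqr_ge0//; lra.
have p22 : p - 2 + 2 = p by lra.
rewrite p22 in HC1.
(* Young's inequality spends half of the reaction coefficient [delta - lam]; the factor
   [2 / (delta - lam)] below normalizes the other half to 1. *)
have [|||||C2 C20 HC2] := @weighted_young R C1 ((delta - lam) / 2) m (p - 1 + delta) (2 * beta).
- by [].
- by lra.
- by [].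
- by lra.
- by lra.
rewrite kE in HC2.
exists (2 / (delta - lam) * C2), (2 / (delta - lam)), lam.
split; [by rewrite !mulr_gt0// invr_gt0|by rewrite divr_ge0// ltW|].
move=> gamma w g t s X Y D a1 r1 a2 r2 dg w0 mg t0 /andP[s0 s1] X0 Y0 DXY a1D r1D a2D r2D.
have g0 : 0 < g by exact: lt_le_trans mg.
have lamd0 : delta - lam != 0 by rewrite gt_eqF.
(* Where [psi] vanishes every power of it is 0, because the exponents [k], [k - 1], [k / 2] and
   [k / 2 - 1] are all nonzero. Elsewhere powers of [s] can be divided. *)
have [sE|sN] := eqVneq s 0.
  have -> : a1 = 0 by rewrite a1D sE powR0 ?mulr0.
  have -> : r1 = 0 by rewrite r1D sE powR0 ?mulr0.
  have -> : a2 = 0 by rewrite a2D sE powR0 ?mulr0.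
  have -> : r2 = 0 by rewrite r2D sE powR0 ?mulr0.
  rewrite sE mul0r !powR0//.
  rewrite !(mul0r, mulr0, expr0n, addr0, subr0)/=.
  rewrite !(mul0r, mulr0, expr0n, addr0, subr0, if_same)/=.
  by rewrite !mulr_ge0 ?powR_ge0 ?invr_ge0 ?ltW.
have {}s0 : 0 < s by rewrite lt_neqAle eq_sym sN.
have s0w := ltW s0; have t0w := ltW t0.
have ti0 : 0 <= t^-1 by rewrite invr_ge0.
have tN : t != 0 by rewrite gt_eqF.
(* Since [a = 2 * b + 1], [P] factors out of both gradient terms, leaving quadratic forms in [Z] and
   [Y] with cross term [V * D]. *)
pose q0 := t `^ (- b) * s `^ (k / 2 - 1).
pose P := q0 ^+ 2; pose Z := s * X / t; pose V := s / t.
have V0 : 0 <= V by rewrite divr_ge0// ltW.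
have Z0 : 0 <= Z by rewrite divr_ge0 ?mulr_ge0// ltW.
have pD x y z : x != 0 -> x `^ (y + z) = x `^ y * x `^ z :> R.
  by move=> xn0; rewrite powRD// xn0 implybT.
have pB1 x y : x != 0 -> 0 <= x -> x `^ (y - 1) = x `^ y / x :> R.
  by move=> xn0 x0; rewrite pD// powRN powRr1.
have pM2 x y : x != 0 -> x `^ (2 * y) = (x `^ y) ^+ 2 :> R.
  by move=> xn0; rewrite expr2 -pD//; congr (_ `^ _); ring.
have phi2E : t `^ (- b) * s `^ (k / 2) = q0 * s.
  by rewrite /q0 pB1 ?ltW//; field.
have a2E : a2 = - b * q0 * s / t.
  by rewrite a2D /q0 !pB1 ?ltW//; field; rewrite tN.
have r2E : r2 = k / 2 * q0 by rewrite r2D /q0; ring.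
have skE : s `^ k = (s `^ (k / 2 - 1)) ^+ 2 * s ^+ 2.
  by rewrite -pM2// -powR_mulrn ?ltW// -pD//; congr (_ `^ _); field.
have taE : t `^ (- a) = (t `^ (- b)) ^+ 2 / t.
  rewrite -pM2// -[X in _ / X]powRr1 ?ltW// -powRN -pD//; congr (_ `^ _).
  by rewrite ab; ring.
have phi1E : t `^ (- a) * s `^ k = P * s ^+ 2 / t.
  by rewrite taE skE /P /q0; field; rewrite ?tN ?sN.
have a1E : a1 = - a * P * s ^+ 2 / t ^+ 2.
  by rewrite a1D pB1 ?ltW// taE skE /P /q0; field.
have r1E : r1 = k * P * s / t.
  by rewrite r1D [s `^ (k - 1)]pB1 ?ltW// taE skE /P /q0; field; rewrite tN sN.
(* Because [k = a + delta], the [delta] parts of both reaction terms are multiples of the single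
   quantity [g * V ^ k]. *)
have VkE : P * s ^+ 2 / t * t `^ (- delta) = V `^ k.
  rewrite -phi1E /V powRM//.
  rewrite -[t^-1]powR_inv1// -powRrM.
  have -> : -1 * k = - a + - delta by rewrite kad; ring.
  by rewrite [t `^ (_ + _)]pD//; ring.
have P0 : 0 <= P by exact: sqr_ge0.
have DZ : `|V * D| <= Z * Y.
  rewrite normrM (ger0_norm V0).
  have -> : Z * Y = V * (X * Y) by rewrite /Z /V; ring.
  by rewrite ler_wpM2l.
set N2 := (if X == 0 then _ else _).
set E2 := _ + r2 ^+ 2 * _.
have E2E : E2 = P * (b ^+ 2 * Z ^+ 2 - b * k * (V * D) + (k / 2) ^+ 2 * Y ^+ 2).
  by rewrite /E2 a2E r2E /P /Z /V; field.
(* Cauchy-Schwarz bounds the middle stability term by the first one. At [X = 0] the left side is 0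
   by convention, and the claim is that [E2] is nonnegative. *)
have hN2 : N2 <= X `^ (p - 2) * E2.
  rewrite /N2; case: eqVneq => [->|XN].
    rewrite mulr_ge0 ?powR_ge0// E2E mulr_ge0// -[X in b * X](divfK (_ : 2 != 0))//.
    rewrite [k / 2 * 2]mulrC; apply: cross_term_ge0 => //.
  have -> : X `^ (p - 2) = X `^ (p - 4) * X ^+ 2.
    by rewrite -powR_mulrn// -pD//; congr (_ `^ _); ring.
  by rewrite -mulrA ler_wpM2l ?powR_ge0// combination_sqr_le.
have E1E : a1 * X ^+ 2 + r1 * D = P * (- a * Z ^+ 2 + k * (V * D)).
  by rewrite a1E r1E /Z /V; field.
have quad : (p - 1) * E2 + lam * (a1 * X ^+ 2 + r1 * D)
    <= P * (- (lam * a - (p - 1) * b ^+ 2) * Z ^+ 2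
            + k * `|lam - (p - 1) * b| * Z * Y + (p - 1) * (k / 2) ^+ 2 * Y ^+ 2).
  rewrite E1E E2E.
  have -> : (p - 1) * (P * (b ^+ 2 * Z ^+ 2 - b * k * (V * D) + (k / 2) ^+ 2 * Y ^+ 2))
     + lam * (P * (- a * Z ^+ 2 + k * (V * D)))
     = P * (- (lam * a - (p - 1) * b ^+ 2) * Z ^+ 2
            + k * ((lam - (p - 1) * b) * (V * D)) + (p - 1) * (k / 2) ^+ 2 * Y ^+ 2).
    by ring.
  rewrite ler_wpM2l// lerD2r lerD2l.
  have -> : k * `|lam - (p - 1) * b| * Z * Y = k * (`|lam - (p - 1) * b| * (Z * Y)) by ring.
  rewrite ler_wpM2l ?(ltW k0)//.
  by apply: le_trans (ler_norm _) _; rewrite normrM ler_wpM2l.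
(* The exponent of [t] is [- 2 * b + (p - 2) = - (2 * beta)], which explains the choice of [b]. *)
have XZ : X `^ (p - 2) * P = Z `^ (p - 2) * (t `^ (- (2 * beta)) * s `^ (k - p)).
  rewrite /Z powRM ?mulr_ge0// powRM//.
  rewrite -[t^-1]powR_inv1// -powRrM /P /q0 exprMn -!pM2//.
  have -> : s `^ (2 * (k / 2 - 1)) = s `^ (p - 2) * s `^ (k - p).
    by rewrite -pD//; congr (_ `^ _); field.
  have -> : t `^ (2 * - b) = t `^ (-1 * (p - 2)) * t `^ (- (2 * beta)).
    by rewrite -pD//; congr (_ `^ _); rewrite mulrN b2; ring.
  ring.
have main : X `^ (p - 2) * ((p - 1) * E2 + lam * (a1 * X ^+ 2 + r1 * D))
    <= C1 * V `^ (2 * beta) * Y `^ p.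
  apply: le_trans (ler_wpM2l (powR_ge0 _ _) quad) _.
  rewrite mulrA XZ.
  set U := _ * s `^ _.
  have U0 : 0 <= U by rewrite mulr_ge0 ?powR_ge0.
  apply: (@le_trans _ _ (U * (C1 * Y `^ p))).
    rewrite [Z `^ (p - 2) * U]mulrC -[U * _ * _]mulrA.
    by apply: ler_wpM2l => //; exact: HC1.
  have -> : C1 * V `^ (2 * beta) * Y `^ p = V `^ (2 * beta) * (C1 * Y `^ p) by ring.
  rewrite ler_wpM2r ?mulr_ge0 ?powR_ge0 ?(ltW C10)//.
  rewrite /U /V powRM// mulrC.
  rewrite -[t^-1]powR_inv1// -powRrM mulN1r.
  (* Here [delta >= 1] acts: it gives [2 * beta <= k - p], so [s ^ (k - p) <= s ^ (2 * beta)] for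
     [0 < s <= 1]. *)
  by rewrite ler_wpM2r ?powR_ge0// ger_powR ?s0.
(* The [gamma] parts combine with coefficient [- (gamma - lam)], negative since
   [lam < delta < gamma], and are discarded. *)
have react : - g * fnl' delta gamma t * (q0 * s) ^+ 2
     - lam * (g * fnl delta gamma t * (P * s ^+ 2 / t))
    <= - (delta - lam) * (g * V `^ k).
  rewrite /fnl /fnl' !pB1// -VkE.
  have : 0 <= (gamma - lam) * (g * (P * s ^+ 2 / t * t `^ (- gamma))).
    by rewrite !mulr_ge0 ?powR_ge0 ?invr_ge0 ?sqr_ge0// ?ltW// subr_gt0 (lt_trans lamd).
  rewrite /P => h.
  rewrite -subr_ge0; set Q := (X in 0 <= X).
  suff -> : Q = (gamma - lam) * (g * (q0 ^+ 2 * s ^+ 2 / t * t `^ (- gamma))) by [].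
  rewrite /Q; field.
  by [].
have young := HC2 g V (w * Y `^ p) mg V0 (mulr_ge0 (ltW w0) (powR_ge0 _ _)).
have WE : (w * Y `^ p) `^ (k / (p - 1 + delta)) =
   w `^ (k / (p - 1 + delta)) * Y `^ (p * (k / (p - 1 + delta))).
  by rewrite powRM ?powR_ge0 ?ltW// -powRrM.
rewrite WE in young.
rewrite phi1E phi2E -/V.
set T := _ * Y `^ (_ * _) in young *.
set G := g * V `^ k in react young *.
have hJ : w * X `^ (p - 2) * E2 + (p - 2) * (w * N2)
     + lam * (w * X `^ (p - 2) * (a1 * X ^+ 2 + r1 * D))
     <= C1 * V `^ (2 * beta) * (w * Y `^ p).
  apply: (@le_trans _ _ (w * (X `^ (p - 2) * ((p - 1) * E2 + lam * (a1 * X ^+ 2 + r1 * D))))).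
    have : (p - 2) * (w * N2) <= (p - 2) * (w * (X `^ (p - 2) * E2)).
      by rewrite ler_wpM2l ?ler_wpM2l ?(ltW w0).
    clear; lra.
  have -> : C1 * V `^ (2 * beta) * (w * Y `^ p) = w * (C1 * V `^ (2 * beta) * Y `^ p) by ring.
  by rewrite ler_wpM2l// ltW.
set J := (X in _ + _ * X <= _).
have -> : G + 2 / (delta - lam) * J = 2 / (delta - lam) * ((delta - lam) / 2 * G + J).
  by clear -lamd0; field.
rewrite -[_ * C2 * T]mulrA; apply: ler_wpM2l; first by rewrite divr_ge0 ?(ltW dl0).
by rewrite /J; clear -hJ react young; lra.
Qed.

(** * Calculus on row vectors *)

Section dot_product.
Context {R : realType} {n : nat}.
Implicit Types (x y z : 'rV[R]_n.+1) (c : R).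

Lemma dotRNC x y : dotRN x y = dotRN y x.
Proof. by apply: eq_bigr => i _; rewrite mulrC. Qed.

Lemma dotRNDl x y z : dotRN (x + y) z = dotRN x z + dotRN y z.
Proof. by rewrite /dotRN -big_split; apply: eq_bigr => i _; rewrite mxE mulrDl. Qed.

Lemma dotRNZl c x y : dotRN (c *: x) y = c * dotRN x y.
Proof. by rewrite /dotRN mulr_sumr; apply: eq_bigr => i _; rewrite mxE mulrA. Qed.

Lemma dotRNDr x y z : dotRN z (x + y) = dotRN z x + dotRN z y.
Proof. by rewrite !(dotRNC z) dotRNDl. Qed.

Lemma dotRNZr c x y : dotRN y (c *: x) = c * dotRN y x.
Proof. by rewrite !(dotRNC y) dotRNZl. Qed.

Lemma dotRN0l y : dotRN 0 y = 0.
Proof. by rewrite -(scale0r 0) dotRNZl mul0r. Qed.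

Lemma dotRN0r y : dotRN y 0 = 0.
Proof. by rewrite dotRNC dotRN0l. Qed.

Lemma dotRN_ge0 x : 0 <= dotRN x x.
Proof. by apply: sumr_ge0 => i _; rewrite -expr2 sqr_ge0. Qed.

Lemma sqr_enorm x : enorm x ^+ 2 = dotRN x x.
Proof. by rewrite sqr_sqrtr ?dotRN_ge0. Qed.

Lemma enorm_ge0 x : 0 <= enorm x.
Proof. exact: sqrtr_ge0. Qed.

Lemma dotRN_eq0 x : (dotRN x x == 0) = (x == 0).
Proof.
apply/eqP/eqP => [h|->]; last by rewrite /dotRN big1// => i _; rewrite mxE mul0r.
apply/rowP => i; rewrite mxE; apply/eqP.
have /eqP := h; rewrite psumr_eq0 => [/allP/(_ i)|j _]; last by rewrite -expr2 sqr_ge0.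
by rewrite mem_index_enum => /(_ isT)/=; rewrite mulf_eq0 orbb.
Qed.

Lemma enorm_eq0 x : (enorm x == 0) = (x == 0).
Proof. by rewrite -dotRN_eq0 -sqr_enorm expf_eq0. Qed.

(** Expand the nonnegative square of the vector [dotRN y y *: x - dotRN x y *: y] and divide by
    [dotRN y y]. *)
Lemma ler_dotRN x y : `|dotRN x y| <= enorm x * enorm y.
Proof.
rewrite -(@ler_pXn2r _ 2) ?nnegrE ?mulr_ge0 ?enorm_ge0//.
rewrite real_normK ?num_real// exprMn !sqr_enorm.
have [/eqP|y0] := eqVneq (dotRN y y) 0.
  rewrite dotRN_eq0 => /eqP ->.
  by rewrite !dotRN0r mulr0 expr0n.
have yp : 0 < dotRN y y by rewrite lt_neqAle eq_sym y0 dotRN_ge0.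
have := dotRN_ge0 (dotRN y y *: x - dotRN x y *: y).
rewrite -scaleNr !(dotRNDl, dotRNDr, dotRNZl, dotRNZr) (dotRNC y x).
rewrite (_ : _ + _ = dotRN y y * (dotRN x x * dotRN y y - dotRN x y ^+ 2)); last by ring.
by rewrite pmulr_rge0// subr_ge0.
Qed.

Lemma sqr_enorm_lin c d x y : enorm (c *: x + d *: y) ^+ 2 =
  c ^+ 2 * enorm x ^+ 2 + 2 * c * d * dotRN x y + d ^+ 2 * enorm y ^+ 2.
Proof.
rewrite !sqr_enorm !(dotRNDl, dotRNDr, dotRNZl, dotRNZr) (dotRNC y x); ring.
Qed.

End dot_product.

Section gradient.
Context {R : realType} {n : nat}.
Implicit Types f g : 'rV[R]_n.+1 -> R.

Lemma C1_continuous {f} : C1 f -> continuous f.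
Proof. by move=> [df _] x; exact: differentiable_continuous. Qed.

(** The outer function is only asked to be differentiable at the values of [f], so that it may be a
    power singular at 0 when [f] is positive. *)
Lemma C1_comp {f} {h h' : R -> R} : C1 f ->
  (forall x, is_derive (f x) 1 h (h' (f x))) ->
  (forall x, {for f x, continuous h'}) ->
  C1 (h \o f) /\ forall x, grad (h \o f) x = h' (f x) *: grad f x.
Proof.
move=> [df cf] dh ch.
have dfh x : differentiable h (f x).
  by apply/derivable1_diffP; have [] := dh x.
have Dhf v x : 'D_v (h \o f) x = h' (f x) * 'D_v f x.
  rewrite deriveE; last exact: differentiable_comp.
  rewrite diff_comp//= deriveE// diff1E// derive1E.
  by have [_ ->] := dh x; rewrite mulrC.
split; last by move=> x; apply/rowP => i; rewrite !mxE Dhf.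
split=> [x|i]; first exact: differentiable_comp.
have -> : (fun x => 'D_(delta_mx ord0 i) (h \o f) x) =
    (fun x => h' (f x) * 'D_(delta_mx ord0 i) f x) by apply/funext => x.
move=> x; have hf : {for x, continuous (h' \o f)}.
  by apply: continuous_comp; [exact: differentiable_continuous|exact: ch].
exact: cvgM hf (cf i x).
Qed.

Lemma C1_mul {f g} : C1 f -> C1 g ->
  C1 (f \* g) /\ forall x, grad (f \* g) x = g x *: grad f x + f x *: grad g x.
Proof.
move=> [df cf] [dg cg].
have Dfg v x : 'D_v (f \* g) x = f x * 'D_v g x + g x * 'D_v f x.
  by rewrite deriveM//; apply: diff_derivable.
split; last by move=> x; apply/rowP => i; rewrite !mxE Dfg addrC.
split=> [x|i]; first exact: differentiableM.
have -> : (fun x => 'D_(delta_mx ord0 i) (f \* g) x) =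
    (fun x => f x * 'D_(delta_mx ord0 i) g x + g x * 'D_(delta_mx ord0 i) f x).
  by apply/funext => x.
move=> x; have fx := differentiable_continuous (df x).
have gx := differentiable_continuous (dg x).
exact: cvgD (cvgM fx (cg i x)) (cvgM gx (cf i x)).
Qed.

Lemma grad_eq0_supp {f x} : ~ closure [set y | f y != 0] x -> grad f x = 0.
Proof.
move=> fx; apply/rowP => i; rewrite !mxE.
rewrite (@near_eq_derive _ _ _ _ (cst 0)) ?derive_cst//.
have : nbhs x (~` closure [set y | f y != 0]).
    by apply: open_nbhs_nbhs; split => //; rewrite openC; exact: closed_closure.
  apply: filterS => y /= fy; apply/eqP/negP => /negP fy0.
  by apply: fy; exact: subset_closure.
Qed.

Lemma C1c_mulr {f g} : C1 f -> C1c g -> C1c (f \* g).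
Proof.
move=> Cf [Cg cg]; split; first exact: proj1 (C1_mul Cf Cg).
apply: (subclosed_compact _ cg); first exact: closed_closure.
by apply: closure_subset => x /=; apply: contra => /eqP ->; rewrite mulr0.
Qed.

Lemma C1c_comp {f} {h : R -> R} : C1 (h \o f) -> h 0 = 0 -> C1c f -> C1c (h \o f).
Proof.
move=> Chf h0 [_ cf]; split=> //.
apply: (subclosed_compact _ cf); first exact: closed_closure.
by apply: closure_subset => x /=; apply: contra => /eqP ->; rewrite h0.
Qed.

End gradient.

Section real_powers.
Context {R : realType}.
Implicit Types r t : R.

Lemma continuous_powR r {t} : 0 < t -> {for t, continuous (@powR R ^~ r)}.
Proof.
move=> t0; apply: differentiable_continuous; apply/derivable1_diffP.
by have [] := is_derive1_powR r t0.
Qed.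

Lemma continuous_norm_powR0 {r} : 0 < r -> {for 0, continuous (fun t => `|t| `^ r)}.
Proof.
move=> r0; rewrite /prop_for /continuous_at normr0 powR0 ?gt_eqF//.
apply/cvgrPdist_lt => e e0; near=> t.
rewrite sub0r normrN ger0_norm ?powR_ge0//.
have -> : e = (e `^ r^-1) `^ r by rewrite -powRrM mulVf ?gt_eqF// powRr1 ?ltW.
apply: gt0_ltr_powR; rewrite ?nnegrE ?powR_ge0//.
near: t; apply: (@nbhs0_lt _ R^o); exact: powR_gt0.
Unshelve. all: by end_near. Qed.

Lemma continuous_norm_powR {r t} : 0 < r -> 0 <= t ->
  {for t, continuous (fun t => `|t| `^ r)}.
Proof.
move=> r0; rewrite le_eqVlt => /predU1P[<-|t0]; first exact: continuous_norm_powR0.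
apply: (@continuous_comp _ _ _ (@Num.norm _ R) (@powR R ^~ r)).
  exact: norm_continuous.
by rewrite gtr0_norm//; exact: continuous_powR.
Qed.

(* The absolute value avoids the library's convention that x `^ r = 1 for x < 0,
   which would break differentiability at 0. *)
Lemma is_derive_norm_powR {r t} : 1 < r -> 0 <= t ->
  is_derive t 1 (fun t => `|t| `^ r) (r * `|t| `^ (r - 1)).
Proof.
move=> r1; rewrite le_eqVlt => /predU1P[<-|t0].
  (* At 0 the difference quotient has absolute value [|h| ^ (r - 1)], which tends to 0 because
     [r > 1]. *)
  have cvg0 : h^-1 *: ((fun t : R => `|t| `^ r) (h *: 1 + 0) - `|0 : R| `^ r)
      @[h --> 0^'] --> (0 : R).
    apply/cvgrPdist_lt => e e0; near=> h.
    have h0 : h != 0 by near: h; exact: nbhs_dnbhs_neq.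
    have r10 : 0 < r - 1 by rewrite subr_gt0.
    rewrite normr0 powR0 ?subr0; last by rewrite gt_eqF// (lt_trans ltr01).
    rewrite addr0 sub0r normrN [h *: 1]mulr1 normrZ normfV (ger0_norm (powR_ge0 _ _)).
    rewrite -mulr_powRB1 ?(lt_trans ltr01)// mulKf ?normr_eq0//.
    have -> : e = (e `^ (r - 1)^-1) `^ (r - 1).
      by rewrite -powRrM mulVf ?gt_eqF// powRr1 ?ltW.
    apply: gt0_ltr_powR; rewrite ?nnegrE ?powR_ge0//.
    near: h; apply: dnbhs0_lt; exact: powR_gt0.
  split; first by apply/cvg_ex; exists 0.
  rewrite normr0 powR0 ?mulr0; last by rewrite gt_eqF// subr_gt0.
  exact: cvg_lim cvg0.
rewrite gtr0_norm//.
apply: (@near_eq_is_derive _ _ _ (@powR R ^~ r)).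
  by near=> s; rewrite gtr0_norm//; near: s; exact: lt_nbhsr.
exact: is_derive1_powR.
Unshelve. all: by end_near. Qed.

End real_powers.

(** * Measurability and integrability *)

Section measurability.
Context {R : realType}.

Lemma measurable_es_vec n (i : 'I_n.+1) :
  measurable_fun setT (fun x => @es_vec R n (leb_space R n) x ord0 i : R).
Proof.
elim: n i => [i|n IH i] /=; first by under eq_fun do rewrite mxE; exact: measurable_id.
have [j ->|j ->] := @split_ordP 1 n.+1 i.
  rewrite (_ : (fun x => _) = snd); first exact: measurable_snd.
  apply/funext => x; apply: (etrans (@row_mxEl R 1 1 n.+1 _ _ _ _)).
  by rewrite mxE.
rewrite (_ : (fun x => _) = (fun y => @es_vec R n (leb_space R n) y ord0 j) \o fst).
  exact: measurableT_comp (IH j) measurable_fst.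
by apply/funext => x; exact: (@row_mxEr R 1 1 n.+1).
Qed.

Context {n : nat}.
Local Notation vec := (@es_vec R n (leb_space R n)).

(** Measurability of [vec] is known coordinate by coordinate, so [O] is cut into the countably many
    half-open grid cells of side [1 / (k + 1)] that lie inside it; the preimage of a cell is a
    finite intersection of coordinate conditions. *)
Lemma measurable_vec_open {O : set 'rV[R]_n.+1} : open O -> measurable (vec @^-1` O).
Proof.
move=> oO.
pose cell (kz : nat * 'rV[int]_n.+1) : set 'rV[R]_n.+1 :=
  [set x | forall i, kz.1.+1%:R * x ord0 i \in `[(kz.2 ord0 i)%:~R, (kz.2 ord0 i)%:~R + 1[%R].
pose F kz := if `[< cell kz `<=` O >] then vec @^-1` cell kz else set0.
have -> : vec @^-1` O = \bigcup_kz F kz.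
  apply/seteqP; split=> [x Ox|x [kz _]]; last first.
    by rewrite /F; case: asboolP => // cO /cO.
  have /nbhs_ballP[e /= e0 xeO] : nbhs (vec x) O by exact: open_nbhs_nbhs.
  pose k := Num.truncn e^-1.
  have ke : k.+1%:R^-1 < e by rewrite invf_plt ?posrE// truncnS_gt.
  exists (k, \row_i Num.floor (k.+1%:R * vec x ord0 i)) => //.
  rewrite /F; have cx : cell (k, \row_i Num.floor (k.+1%:R * vec x ord0 i)) (vec x).
    move=> i; rewrite /= mxE in_itv/= ge_floor/=.
    by have := floorD1_gt (k.+1%:R * vec x ord0 i); rewrite intrD.
  case: asboolP => // -[] y cy; apply: xeO.
  split=> // i j; rewrite ord1 /ball_/=.
  have := cx j; have := cy j; rewrite !in_itv/= => /andP[y1 y2] /andP[x1 x2].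
  (* Two points of one cell differ by less than [1 / (k + 1) < e] in each coordinate, hence in the
     sup norm of the ball. *)
  have : `|k.+1%:R * vec x ord0 j - k.+1%:R * y ord0 j| < 1.
    by rewrite ltr_norml; move: y1 y2 x1 x2; rewrite mxE /=; lra.
  rewrite -mulrBr normrM normr_nat => h.
  by apply: lt_trans ke; rewrite -(@ltr_pM2l _ k.+1%:R)// divff.
apply: countable_bigcupT_measurable => [|kz]; first exact: countableP.
rewrite /F; case: ifP => // _.
rewrite [X in measurable X](_ : _ = \bigcap_(i in [set: 'I_n.+1])
   ((fun x => kz.1.+1%:R * vec x ord0 i) @^-1` `[(kz.2 ord0 i)%:~R, (kz.2 ord0 i)%:~R + 1[)).
  apply: fin_bigcap_measurable => // i _.
  have := @measurable_funM _ _ _ setT (cst kz.1.+1%:R) _ (measurable_cst _) (measurable_es_vec n i).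
  by move=> /(_ measurableT) h; rewrite -[X in measurable X]setTI; apply: h.
by apply/seteqP; split=> [x h i _|x h i] /=; have := h i; [|apply].
Qed.

Lemma measurable_vec_compact {K : set 'rV[R]_n.+1} :
  compact K -> measurable (vec @^-1` K).
Proof.
move=> cK; rewrite -[K]setCK -preimage_setC; apply: measurableC.
apply: measurable_vec_open; rewrite openC.
by apply: compact_closed => //; exact: norm_hausdorff.
Qed.

Lemma continuous_measurableRN (f : 'rV[R]_n.+1 -> R) :
  continuous f -> measurableRN f.
Proof.
move=> /continuousP cf; apply: (measurability _ (RGenOpens.measurableE R)).
move=> _ [_ [a [b ->] <-]]; rewrite setTI comp_preimage.
by apply: measurable_vec_open; apply: cf; exact: interval_open.
Qed.

(* The coefficients multiplying w and g are only required to be locally bounded: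
   |grad u| `^ (p - 2) need not be obtained as a continuous function. *)
Definition locally_bounded_measurable (G : 'rV[R]_n.+1 -> R) :=
  measurableRN G /\
  forall K : set 'rV[R]_n.+1, compact K -> exists M : R, forall x, K x -> `|G x| <= M.

Lemma lbm_continuous (G : 'rV[R]_n.+1 -> R) :
  continuous G -> locally_bounded_measurable G.
Proof.
move=> cG; split; first exact: continuous_measurableRN.
move=> K cK; have /compact_bounded[M [_ HM]] : compact (G @` K).
  by apply: continuous_compact => //; exact: continuous_subspaceT.
by exists (M + 1) => x Kx; apply: (HM (M + 1)); [rewrite ltrDl|exists x].
Qed.

Lemma lbm_cst (c : R) : locally_bounded_measurable (fun=> c).
Proof. by apply: lbm_continuous; exact: cst_continuous. Qed.

Lemma lbm_mul (G H : 'rV[R]_n.+1 -> R) : locally_bounded_measurable G ->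
  locally_bounded_measurable H -> locally_bounded_measurable (fun x => G x * H x).
Proof.
move=> [mG bG] [mH bH]; split; first exact: measurable_funM.
move=> K cK; have [M GM] := bG K cK; have [N HN] := bH K cK.
by exists (M * N) => x Kx; rewrite normrM ler_pM ?GM ?HN.
Qed.

Lemma lbm_add (G H : 'rV[R]_n.+1 -> R) : locally_bounded_measurable G ->
  locally_bounded_measurable H -> locally_bounded_measurable (fun x => G x + H x).
Proof.
move=> [mG bG] [mH bH]; split; first exact: measurable_funD.
move=> K cK; have [M GM] := bG K cK; have [N HN] := bH K cK.
by exists (M + N) => x Kx; rewrite (le_trans (ler_normD _ _))// lerD ?GM ?HN.
Qed.

Lemma lbm_powR (G : 'rV[R]_n.+1 -> R) (r : R) : 0 <= r -> (forall x, 0 <= G x) ->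
  locally_bounded_measurable G -> locally_bounded_measurable (fun x => G x `^ r).
Proof.
move=> r0 G0 [mG bG]; split; first exact: measurableT_comp (measurable_powR r) mG.
move=> K cK; have [M GM] := bG K cK; exists (M `^ r) => x Kx.
have := GM x Kx; rewrite ger0_norm// ger0_norm ?powR_ge0// => h.
by apply: ge0_ler_powR; rewrite ?nnegrE// (le_trans _ h).
Qed.

Lemma lbm_le (G H : 'rV[R]_n.+1 -> R) : measurableRN G ->
  (forall x, `|G x| <= H x) -> locally_bounded_measurable H ->
  locally_bounded_measurable G.
Proof.
move=> mG GH [_ bH]; split=> // K cK; have [M HM] := bH K cK.
by exists M => x Kx; rewrite (le_trans (GH x))// (le_trans _ (HM x Kx))// ler_norm.
Qed.

Local Notation mu := (@es_meas R n (leb_space R n)).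

(** The product vanishes off [K] and is at most a constant times [|w|] on [K]. *)
Lemma L1loc_integrable {w G : 'rV[R]_n.+1 -> R} {K : set 'rV[R]_n.+1} :
  L1loc w -> locally_bounded_measurable G -> compact K ->
  (forall x, ~ K x -> G x = 0) ->
  mu.-integrable setT (EFin \o (fun x => w (vec x) * G (vec x))).
Proof.
move=> [mw iw] [mG bG] cK G0; have [M GM] := bG K cK.
have mK := measurable_vec_compact cK.
have mwG : measurable_fun setT (fun x => w (vec x) * G (vec x)).
  exact: measurable_funM.
apply/integrableP; split; first exact/measurable_EFinP.
rewrite [X in (X < _)%E](_ : _ =
    \int[mu]_(x in vec @^-1` K) (`|w (vec x) * G (vec x)|)%:E)%E; last first.
  rewrite [RHS]integral_mkcond; apply: eq_integral => x _.
  rewrite patchE; case: ifPn => //=.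
  by rewrite notin_setE => /G0 ->; rewrite mulr0 normr0.
(* [|M|] replaces [M], which may be negative when [K] is empty. *)
apply: (@le_lt_trans _ _ (\int[mu]_(x in vec @^-1` K) ((`|M|)%:E * (`|w (vec x)|)%:E))%E).
  apply: ge0_le_integral => //.
  - apply/measurable_EFinP; apply: measurable_funTS.
    exact: (measurableT_comp (@normr_measurable R setT)).
  - apply: measurable_funeM; apply/measurable_EFinP; apply: measurable_funTS.
    exact: (measurableT_comp (@normr_measurable R setT)).
  - move=> x Kx; rewrite -EFinM lee_fin normrM mulrC ler_wpM2r//.
    by rewrite (le_trans (GM _ Kx))// ler_norm.
rewrite ge0_integralZl//; last first.
  apply/measurable_EFinP; apply: measurable_funTS.
  exact: (measurableT_comp (@normr_measurable R setT)).
by rewrite lte_mul_pinfty ?iw.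
Qed.

End measurability.

Section integral_comparison.
Local Open Scope ereal_scope.
Context d (T : measurableType d) (R : realType) (mu : {measure set T -> \bar R}).
Local Notation integ f := (mu.-integrable setT (EFin \o f)).

(** The added bracket integrates to the nonnegative stability expression plus [lam] times the zero
    defect of the weak formulation. Integrability of each piece lets the computation take place in
    [R]. *)
Lemma integral_combination {G S1 S2 S3 A B : T -> R} (q c lam : R) :
  integ G -> integ S1 -> integ S2 -> integ S3 -> integ A -> integ B ->
  (0 <= c)%R ->
  0 <= \int[mu]_x (S1 x)%:E + q%:E * \int[mu]_x (S2 x)%:E - \int[mu]_x (S3 x)%:E ->
  \int[mu]_x (A x)%:E = \int[mu]_x (B x)%:E ->
  integ (fun x => G x + c * (S1 x + q * S2 x - S3 x + lam * (A x - B x)))%R /\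
  \int[mu]_x (G x)%:E <=
  \int[mu]_x (G x + c * (S1 x + q * S2 x - S3 x + lam * (A x - B x)))%:E.
Proof.
move=> iG i1 i2 i3 iA iB c0.
have RE f : integ f -> \int[mu]_x (f x)%:E = (\int[mu]_x f x)%:E.
  by move=> fi; rewrite /Rintegral fineK//; exact: integrable_fin_num fi.
have iD f g : integ f -> integ g -> integ (fun x => f x + g x)%R.
  by move=> fi gi; exact: (integrableD measurableT fi gi).
have iB' f g : integ f -> integ g -> integ (fun x => f x - g x)%R.
  by move=> fi gi; exact: (integrableB measurableT fi gi).
have iZ r f : integ f -> integ (fun x => r * f x)%R.
  by move=> fi; exact: (integrableZl measurableT r fi).
have iAB := iB' _ _ iA iB.
have i4 := iB' _ _ (iD _ _ i1 (iZ q _ i2)) i3.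
have i5 := iD _ _ i4 (iZ lam _ iAB).
have i6 := iD _ _ iG (iZ c _ i5).
rewrite (RE _ i1) (RE _ i2) (RE _ i3) (RE _ iA) (RE _ iB) (RE _ iG).
rewrite (RE _ i6).
rewrite -EFinM -EFinN -!EFinD !lee_fin => h [AB]; split => //.
rewrite RintegralD//; last exact: iZ.
rewrite RintegralZl// RintegralD//; last exact: iZ.
rewrite RintegralB//; last by apply: iD => //; exact: iZ.
rewrite RintegralD//; last exact: iZ.
rewrite RintegralZl// RintegralZl// RintegralB// AB subrr mulr0 addr0.
by rewrite lerDl mulr_ge0.
Qed.

(** [f] may change sign, so the comparison goes through its positive part, still almost everywhere
    below [h]. The integral of [h] may be infinite. *)
Lemma ae_le_integral_nonneg {f h : T -> \bar R} :
  measurable_fun setT f -> measurable_fun setT h -> (forall x, 0 <= h x) ->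
  (\forall x \ae mu, f x <= h x) -> \int[mu]_x f x <= \int[mu]_x h x.
Proof.
move=> mf mh h0 fh.
apply: (@le_trans _ _ (\int[mu]_x f^\+ x)).
  rewrite integralE -[leRHS]adde0 leeD2l// oppe_le0; exact: integral_ge0.
apply: ae_ge0_le_integral => //.
- exact: measurable_funepos.
- by apply: filterS fh => x fhx _; rewrite funeposE ge_max fhx h0.
Qed.

End integral_comparison.

(** * Test functions built from powers, and bounds for gradients *)

Section test_functions.
Context {R : realType} {n : nat}.
Implicit Types f u psi : 'rV[R]_n.+1 -> R.

(** Positivity of [u] allows any real [q], while [r > 1] makes [|psi| ^ r] continuously
    differentiable across the zeros of [psi]. *)
Lemma power_test_function {u psi} (q r : R) : C1 u -> (forall x, 0 < u x) ->
  C1c psi -> (forall x, 0 <= psi x) -> 1 < r ->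
  let phi := fun x => u x `^ q * psi x `^ r in
  C1c phi /\ forall x, grad phi x = (q * u x `^ (q - 1) * psi x `^ r) *: grad u x
    + (u x `^ q * (r * psi x `^ (r - 1))) *: grad psi x.
Proof.
move=> Cu u0 Cpsi psi0 r1 phi.
have [||Cuq guq] := @C1_comp _ _ u (@powR R ^~ q) (fun t => q * t `^ (q - 1)) Cu.
- by move=> x; exact: is_derive1_powR.
- move=> x; apply: (@continuousM _ _ (cst q)); first exact: cst_continuous.
  exact: continuous_powR.
have [||Cpr gpr] := @C1_comp _ _ psi (fun t => `|t| `^ r)
    (fun t => r * `|t| `^ (r - 1)) (proj1 Cpsi).
- by move=> x; exact: is_derive_norm_powR.
- move=> x; apply: (@continuousM _ _ (cst r)); first exact: cst_continuous.
  by apply: continuous_norm_powR; rewrite ?subr_gt0.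
have phiE : phi = (@powR R ^~ q \o u) \* ((fun t => `|t| `^ r) \o psi).
  by apply/funext => x; rewrite /phi /= ger0_norm.
rewrite phiE; split.
  apply: C1c_mulr => //; apply: C1c_comp => //.
  by rewrite normr0 powR0// gt_eqF// (lt_trans ltr01).
move=> x; have [_ ->] := C1_mul Cuq Cpr.
by rewrite guq gpr !scalerA /= ger0_norm// [(_ `^ r * _)%R]mulrC.
Qed.

Lemma lbm_dot_grad f u : C1 f -> C1 u ->
  locally_bounded_measurable (fun x => dotRN (grad f x) (grad u x)).
Proof.
move=> [_ cf] [_ cu].
have -> : (fun x => dotRN (grad f x) (grad u x)) =
   (fun x => \sum_(i <- index_enum 'I_n.+1)
       'D_(delta_mx ord0 i) f x * 'D_(delta_mx ord0 i) u x).
  by apply/funext => x; apply: eq_bigr => i _; rewrite !mxE.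
elim: (index_enum _) => [|i s IH].
  by under eq_fun do rewrite big_nil; exact: lbm_cst.
under eq_fun do rewrite big_cons.
by apply: lbm_add IH; apply: lbm_mul; apply: lbm_continuous.
Qed.

Lemma lbm_enorm_grad f : C1 f -> locally_bounded_measurable (fun x => enorm (grad f x)).
Proof.
move=> Cf; have -> : (fun x => enorm (grad f x)) =
    (fun x => dotRN (grad f x) (grad f x) `^ 2^-1).
  by apply/funext => x; rewrite powR12_sqrt// dotRN_ge0.
apply: lbm_powR; [by rewrite invr_ge0|by move=> x; exact: dotRN_ge0|].
exact: lbm_dot_grad.
Qed.

Lemma continuous_comp_powR u (q : R) : continuous u -> (forall x, 0 < u x) ->
  continuous (fun x => u x `^ q).
Proof.
move=> cu u0 x; apply: (@continuous_comp _ _ _ u (@powR R ^~ q)); first exact: cu.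
exact: continuous_powR.
Qed.

End test_functions.

(** * The integral estimate *)

Theorem theorem3p1 (R : realType) (p delta beta m : R) :
  2 <= p -> 0 < delta -> class_Pa delta p ->
  0 < beta -> beta < s_p p delta ->
  exists c : R, 0 < c /\
  forall (n : nat) (w g u : 'rV[R]_n.+1 -> R) (gamma : R),
    L1loc w -> L1loc g ->
    ae_RN (fun x => 0 < w x) -> ae_RN (fun x => 0 < g x) ->
    esssup_abs (fun x => (g x)^-1) = m%:E ->
    delta < gamma ->
    C1 u -> (forall x, 0 < u x <= 1) ->
    weak_solution p delta gamma w g u ->
    stable p delta gamma w g u ->
    forall psi : 'rV[R]_n.+1 -> R,
      C1c psi -> (forall x, 0 <= psi x <= 1) ->
      (intRN (fun x => (g x * (psi x / u x) `^ (2 * beta + p - 1 + delta))%:E)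
       <= c%:E * intRN (fun x =>
            ((w x) `^ ((2 * beta + p - 1 + delta) / (p - 1 + delta))
             * (enorm (grad psi x)) `^ (p * ((2 * beta + p - 1 + delta) / (p - 1 + delta))))%:E))%E.
Proof.
move=> p2 d0 /class_Pa_ge1 d1 be0 bes.
have [k kD] : exists k, k = 2 * beta + p - 1 + delta by eexists.
have [a aD] : exists a, a = 2 * beta + p - 1 by eexists.
have [b bD] : exists b, b = beta + (p - 2) / 2 by eexists.
(* The constant is fixed before [g] is, with no sign known for [m]; this number is positive in any
   case and bounds [g] from below almost everywhere. *)
have m10 : 0 < (`|m| + 1)^-1 by rewrite invr_gt0 ltr_wpDl.
have [c [mu0 [lam [c0 mu00 energy]]]] :=
  @energy_pointwise R p delta beta _ k a b kD aD bD p2 d1 be0 bes m10.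
have k2 : 1 < k / 2 by lra.
have k1 : 1 < k by lra.
have kN0 : k != 0 by lra.
have kN1 : k - 1 != 0 by lra.
have p20 : 0 <= p - 2 by lra.
exists c; split => // n w g u gamma iw ig w0 g0 gm dg Cu u01 wsol stab psi Cpsi psi01.
rewrite -kD.
have u0 x : 0 < u x by case/andP: (u01 x).
have psi0 x : 0 <= psi x by case/andP: (psi01 x).
have [Cphi1 gphi1] := power_test_function (- a) k Cu u0 Cpsi psi0 k1.
have [Cphi2 gphi2] := power_test_function (- b) (k / 2) Cu u0 Cpsi psi0 k2.
set phi1 := (fun x => u x `^ (- a) * _) in Cphi1 gphi1.
set phi2 := (fun x => u x `^ (- b) * _) in Cphi2 gphi2.
have [_ wk] := wsol; have {}wk := wk _ Cphi1.
have {}stab := stab _ Cphi2.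
pose X x := enorm (grad u x).
pose K := closure [set x | psi x != 0].
have cK : compact K by case: Cpsi.
have psiK x : ~ K x -> psi x = 0.
  move=> Kx; apply/eqP/negP => /negP h; apply: Kx; exact: subset_closure.
have gphi1K x : ~ K x -> grad phi1 x = 0.
  by move=> Kx; rewrite gphi1 (psiK _ Kx) (grad_eq0_supp Kx) powR0// mulr0 scale0r scaler0 addr0.
have gphi2K x : ~ K x -> grad phi2 x = 0.
  move=> Kx; rewrite gphi2 (psiK _ Kx) (grad_eq0_supp Kx) powR0.
    by rewrite mulr0 scale0r scaler0 addr0.
  by rewrite gt_eqF// (lt_trans ltr01).
have cu := C1_continuous Cu; have cphi1 := C1_continuous (proj1 Cphi1).
have cphi2 := C1_continuous (proj1 Cphi2).
have lX : locally_bounded_measurable (fun x => X x `^ (p - 2)).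
  by apply: lbm_powR => //; [move=> x; exact: enorm_ge0|exact: lbm_enorm_grad].
have lup q : locally_bounded_measurable (fun x => u x `^ q).
  by apply: lbm_continuous; exact: continuous_comp_powR.
have lE2 : locally_bounded_measurable (fun x => X x `^ (p - 2) * enorm (grad phi2 x) ^+ 2).
  have lE := lbm_enorm_grad _ (proj1 Cphi2).
  exact: lbm_mul lX (lbm_mul _ _ lE lE).
have ldot := lbm_dot_grad _ _ Cu (proj1 Cphi2).
(* The exponent [p - 4] may be negative, so local boundedness comes from Cauchy-Schwarz, which
   restores the power [p - 2]; where [grad u] is 0 the scalar product is 0. *)
have lmid : locally_bounded_measurable
    (fun x => X x `^ (p - 4) * dotRN (grad u x) (grad phi2 x) ^+ 2).
  apply: (@lbm_le _ _ _ (fun x => X x `^ (p - 2) * enorm (grad phi2 x) ^+ 2)) => //.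
    apply: measurable_funM; last exact: measurable_funX (proj1 ldot).
    exact: measurableT_comp (measurable_powR _) (proj1 (lbm_enorm_grad _ Cu)).
  move=> x; rewrite ger0_norm; last by rewrite mulr_ge0 ?powR_ge0 ?sqr_ge0.
  have hd := ler_dotRN (grad u x) (grad phi2 x).
  have [X0|X0] := eqVneq (X x) 0.
    move: hd; rewrite -/(X x) X0 mul0r normr_le0 => /eqP ->.
    by rewrite expr0n mulr0 mulr_ge0 ?powR_ge0 ?sqr_ge0.
  have -> : X x `^ (p - 2) = X x `^ (p - 4) * X x ^+ 2.
    rewrite -powR_mulrn ?enorm_ge0// -powRD ?X0 ?implybT//.
    by congr (_ `^ _); ring.
  rewrite -mulrA -exprMn ler_wpM2l ?powR_ge0//.
  by rewrite -[leLHS]real_normK ?num_real// lerXn2r ?nnegrE ?mulr_ge0 ?enorm_ge0.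
pose mu := @es_meas R n (leb_space R n).
pose vec := @es_vec R n (leb_space R n).
pose S1 x := w x * X x `^ (p - 2) * enorm (grad phi2 x) ^+ 2.
pose S2 x := w x * (if grad u x == 0 then 0
  else X x `^ (p - 4) * dotRN (grad u x) (grad phi2 x) ^+ 2).
pose S3 x := g x * fnl' delta gamma (u x) * phi2 x ^+ 2.
pose A x := w x * X x `^ (p - 2) * dotRN (grad u x) (grad phi1 x).
pose B x := g x * fnl delta gamma (u x) * phi1 x.
pose G x := g x * (psi x / u x) `^ k.
have iS1 : mu.-integrable setT (EFin \o (fun x => S1 (vec x))).
  rewrite (_ : S1 = fun x => w x * (X x `^ (p - 2) * enorm (grad phi2 x) ^+ 2)).
    apply: (L1loc_integrable iw lE2 cK) => x /gphi2K ->.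
    by rewrite sqr_enorm dotRN0r mulr0.
  by apply/funext => x; rewrite /S1 mulrA.
have iS2 : mu.-integrable setT (EFin \o (fun x => S2 (vec x))).
  (* The case distinction disappears: where [grad u] is 0, the scalar product kills whatever value
     the power takes. *)
  rewrite (_ : S2 = fun x => w x * (X x `^ (p - 4) * dotRN (grad u x) (grad phi2 x) ^+ 2)).
    apply: (L1loc_integrable iw lmid cK) => x /gphi2K ->.
    by rewrite dotRN0r expr0n/= mulr0.
  apply/funext => x; rewrite /S2; case: eqP => // ->.
  by rewrite dotRN0l expr0n/= !mulr0.
have lS3 : locally_bounded_measurable (fun x => fnl' delta gamma (u x) * (phi2 x * phi2 x)).
  apply: lbm_mul; first by apply: lbm_add; apply: lbm_mul => //; exact: lbm_cst.
  by apply: lbm_mul; exact: lbm_continuous.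
have iS3 : mu.-integrable setT (EFin \o (fun x => S3 (vec x))).
  rewrite (_ : S3 = fun x => g x * (fnl' delta gamma (u x) * (phi2 x * phi2 x))).
    apply: (L1loc_integrable ig lS3 cK) => x /psiK h.
    by rewrite /phi2 h powR0 ?mulr0// gt_eqF// (lt_trans ltr01).
  by apply/funext => x; rewrite /S3 mulrA.
have lA : locally_bounded_measurable
    (fun x => X x `^ (p - 2) * dotRN (grad u x) (grad phi1 x)).
  by apply: lbm_mul => //; exact: lbm_dot_grad (proj1 Cphi1).
have iA : mu.-integrable setT (EFin \o (fun x => A (vec x))).
  rewrite (_ : A = fun x => w x * (X x `^ (p - 2) * dotRN (grad u x) (grad phi1 x))).
    by apply: (L1loc_integrable iw lA cK) => x /gphi1K ->; rewrite dotRN0r mulr0.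
  by apply/funext => x; rewrite /A mulrA.
have lB : locally_bounded_measurable (fun x => fnl delta gamma (u x) * phi1 x).
  apply: lbm_mul; last exact: lbm_continuous.
  have lN q : locally_bounded_measurable (fun x => - u x `^ q).
    apply: lbm_continuous => x; exact: cvgN (continuous_comp_powR u q cu u0 x).
  by apply: lbm_add; exact: lN.
have iB : mu.-integrable setT (EFin \o (fun x => B (vec x))).
  rewrite (_ : B = fun x => g x * (fnl delta gamma (u x) * phi1 x)).
    by apply: (L1loc_integrable ig lB cK) => x /psiK h; rewrite /phi1 h powR0 ?mulr0.
  by apply/funext => x; rewrite /B mulrA.
have lG : locally_bounded_measurable (fun x => (psi x / u x) `^ k).
  apply: lbm_powR; first by rewrite ltW// (lt_trans ltr01).
    by move=> x; rewrite divr_ge0 ?(ltW (u0 x)).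
  apply: lbm_continuous => x.
  have ux : u x != 0 by rewrite gt_eqF.
  exact: cvgM (C1_continuous (proj1 Cpsi) x) (cvgV ux (cu x)).
have iG : mu.-integrable setT (EFin \o (fun x => G (vec x))).
  by apply: (L1loc_integrable ig lG cK) => x /psiK h; rewrite h mul0r powR0.
have mH : measurable_fun setT (fun x => w (vec x) `^ (k / (p - 1 + delta)) *
    enorm (grad psi (vec x)) `^ (p * (k / (p - 1 + delta)))).
  apply: measurable_funM; first exact: measurableT_comp (measurable_powR _) (proj1 iw).
  exact: measurableT_comp (measurable_powR _) (proj1 (lbm_enorm_grad _ (proj1 Cpsi))).
have [itot] := @integral_combination _ _ _ mu _ _ _ _ _ _ (p - 2) mu0 lam
  iG iS1 iS2 iS3 iA iB mu00 stab wk.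
move=> /le_trans; apply.
rewrite -ge0_integralZl_EFin//; last 3 first.
- by move=> x _; rewrite lee_fin mulr_ge0 ?powR_ge0.
- exact/measurable_EFinP.
- exact: ltW.
(* The exponent of [w] exceeds 1, so local integrability of [w] does not make the right-hand
   integral finite. *)
apply: ae_le_integral_nonneg.
- exact: measurable_int itot.
- by apply: measurable_funeM; exact/measurable_EFinP.
- by move=> x; rewrite mule_ge0// lee_fin ?mulr_ge0 ?powR_ge0 ?(ltW c0).
have gm' : \forall x \ae mu, (`|(g (vec x))^-1|%:E <= m%:E)%E.
  by rewrite -gm; exact: ess_sup_ge.
have w0' : \forall x \ae mu, 0 < w (vec x) by exact: w0.
have g0' : \forall x \ae mu, 0 < g (vec x) by exact: g0.
move: w0' g0' gm'; apply: filterS3 => x wx gx; rewrite lee_fin => gmx.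
rewrite -EFinM lee_fin.
have mg : (`|m| + 1)^-1 <= g (vec x).
  rewrite -[leRHS]invrK lef_pV2 ?posrE ?invr_gt0 ?ltr_wpDl//.
  apply: le_trans (ler_norm _) _; apply: le_trans gmx _.
  by rewrite (le_trans (ler_norm _))// lerDl.
have := energy gamma (w (vec x)) (g (vec x)) (u (vec x)) (psi (vec x)) (X (vec x))
  (enorm (grad psi (vec x))) (dotRN (grad u (vec x)) (grad psi (vec x)))
  _ _ _ _ dg wx mg (u0 _) (psi01 _) (enorm_ge0 _) (enorm_ge0 _) (ler_dotRN _ _)
  erefl erefl erefl erefl.
(* Expanding the gradients of both test functions turns the integrand into the scalar expression of
   [energy]. *)
rewrite /S1 /S2 /S3 /A /B /G -enorm_eq0 gphi1 gphi2 sqr_enorm_lin !dotRNDr !dotRNZr.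
by rewrite -sqr_enorm.
Qed.
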